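(* Let $F$ be an algebraically closed field and let $A$ be a symmetric local $F$-algebra of dimension $\dim A \leq 11$. Then $J(Z(A))$ is an ideal in $A$.
   Context: All $F$-algebras are finite-dimensional, associative and unitary. ''Ideal'' means two-sided ideal. $Z(A)$ is the center of $A$ and $J(Z(A))$ is the Jacobson radical of the commutative algebra $Z(A)$. An $F$-algebra $A$ is symmetric if it admits a non-degenerate, associative (i.e. $\beta(ab,c)=\beta(a,bc)$), symmetric bilinear form $\beta\colon A\times A\to F$. $A$ is local if $A/J(A)$ is a division ring (equivalently $A/J(A)\cong F$, as $F$ is algebraically closed). *)

(* Defs.v *)
From mathcomp Require Import all_boot all_order all_algebra all_field.

Set Implicit Arguments.
Unset Strict Implicit.
Unset Printing Implicit Defensive.

Import GRing.Theory.
Local Open Scope ring_scope.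

Section RingNotions.
Variable R : nzRingType.
Implicit Type I M : R -> Prop.

Definition left_ideal I :=
  [/\ I 0, forall x y, I x -> I y -> I (x + y) & forall a x, I x -> I (a * x)].

Definition ideal I := left_ideal I /\ (forall a x, I x -> I (x * a)).

Definition maximal_left_ideal M :=
  [/\ left_ideal M, ~ M 1 &
      forall I, left_ideal I -> (forall x, M x -> I x) -> ~ I 1 ->
        forall x, I x -> M x].

Definition jacobson (x : R) : Prop := forall M, maximal_left_ideal M -> M x.

(* The quotient R / J(R) is a division ring, written on representatives
   (MathComp only quotients commutative rings by ideals): it is nonzero and
   each of its nonzero classes has a two-sided inverse. *)
Definition is_local : Prop :=
  ~ jacobson 1 /\
  (forall x, ~ jacobson x ->
     exists y, jacobson (x * y - 1) /\ jacobson (y * x - 1)).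

End RingNotions.

Arguments is_local R : clear implicits.

Section AlgebraNotions.
Variables (F : fieldType) (A : falgType F).

Definition symmetric_algebra : Prop :=
  exists beta : {symmetric A},
    nondegenerate beta /\ (forall a b c, beta (a * b) c = beta a (b * c)).

(* J(Z(A)) as a subset of A; the radical is taken in the algebra Z(A) itself. *)
Definition jacobson_center (x : A) : Prop :=
  exists2 z : subvs_of 'Z({:A})%AS, jacobson z & vsval z = x.

End AlgebraNotions.

Arguments symmetric_algebra {F} A.
Arguments jacobson_center {F} A x.

(* Main.v *)
(** Write K for the span of the commutators, let lam be a symmetrizing linear
    form and let z be a central element of J = J(A).  The claim is z K = 0.
    The ideal A z is isomorphic to A / ann(z), again symmetric and local, with
    commutator space z K; quotients are avoided by working with "commutators
    twisted by z", (a b - b a) z, and with the preimage C of the center under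
    multiplication by z.

    If A = C + F x + F y, then w = (x y - y x) z spans z K, w A <= F w, and
    lam w = 0 forces w = 0; hence codim C >= 3 whenever z K <> 0.

    If dim A z >= 8, then A z + F has codimension at most 2 in A, and this
    argument, applied to the powers of z by descending induction, shows that A
    is commutative.

    If z K <> 0, then dim z K >= codim C >= 3, dim z J^2 >= 4 since lam kills
    z K but not the nonzero ideal z J^2, and dim z J >= dim z J^2 + 2 by
    Nakayama.  So dim A z <= 7 leaves only the dimensions 7, 6, 4 for A z, z J,
    z J^2, where z J^2 is spanned modulo z J^3 by a single commutator; this
    forces z J^3 = z J^4 = 0, contradicting dim z K >= 3. *)

Require Import Defs.
From mathcomp Require Import all_boot all_order all_algebra all_field.
From mathcomp Require Import zify.

Set Implicit Arguments.
Unset Strict Implicit.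
Unset Printing Implicit Defensive.

Import GRing.Theory.
Local Open Scope ring_scope.

(** * Subspaces spanned by at most two vectors *)

Lemma dimv_le1 (K : fieldType) (vT : vectType K) (V : {vspace vT}) :
  (\dim V <= 1)%N -> exists x, V = <[x]>%VS.
Proof.
move: (size_tuple (vbasis V)) (span_basis (vbasisP V)).
case: (tval (vbasis V)) => [|x [|y s]] /= <- // <- _.
  by exists 0; rewrite span_nil; apply/esym/eqP;
    rewrite -dimv_eq0 dim_vline eqxx.
by exists x; rewrite span_seq1.
Qed.

Lemma dimv_le2 (K : fieldType) (vT : vectType K) (V : {vspace vT}) :
  (\dim V <= 2)%N -> exists x y, V = (<[x]> + <[y]>)%VS.
Proof.
move=> d2; have [/dimv_le1[x ->] | d1] := leqP (\dim V) 1.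
  by exists x, x; rewrite addvv.
move: (size_tuple (vbasis V)) (span_basis (vbasisP V)) d1 d2.
case: (tval (vbasis V)) => [|x [|y [|z s]]] /= <- // <- _ _.
by exists x, y; rewrite span_cons span_seq1.
Qed.

(** * Units and the Jacobson radical *)

Section JacobsonRadical.
Variables (F : fieldType) (A : falgType F).
Implicit Types (x y : A) (U : {vspace A}).

(** Left multiplication by [x] is injective, hence surjective in finite dimension. *)
Lemma unitr_left_inverse x y : y * x = 1 -> x \is a GRing.unit.
Proof.
move=> yx1; have kx : lker (amull x) == 0%VS.
  apply/lker0P=> u v; rewrite !lfunE /= => /(congr1 ( *%R y)).
  by rewrite !mulrA yx1 !mul1r.
have /memv_imgP[w _] : 1 \in limg (amull x) by rewrite lker0_limgf ?memvf.
rewrite lfunE /= => xw1; apply/unitrP; exists y; split=> //.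
by rewrite {1}xw1 -[w]mul1r -yx1 -mulrA -xw1 mulr1.
Qed.

Lemma unitr_mulr x y : x * y \is a GRing.unit -> y \is a GRing.unit.
Proof.
by move=> Uxy; apply: (@unitr_left_inverse _ ((x * y)^-1 * x));
  rewrite -mulrA mulVr.
Qed.

Lemma unitr_mull x y : x * y \is a GRing.unit -> x \is a GRing.unit.
Proof.
move=> Uxy; have Uy := unitr_mulr Uxy.
by rewrite -[x](mulrK Uy) unitrMl ?unitrV.
Qed.

Lemma jacobson_left_ideal : left_ideal (@jacobson A).
Proof.
split=> [M [[]]|x y Jx Jy M Mmax|a x Jx M Mmax] //.
  by have [[_ MD _] _ _] := Mmax; apply: MD; [apply: Jx | apply: Jy].
by have [[_ _ MM] _ _] := Mmax; apply: MM; apply: Jx.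
Qed.

(* A proper left ideal of maximal dimension containing u is a maximal left
   ideal; the goal being False, no choice is needed to find one. *)
Lemma unitr_avoid_maximal (u : A) :
  (forall M, maximal_left_ideal M -> ~ M u) -> u \is a GRing.unit.
Proof.
move=> avoid; apply: contraT => nUu.
suff grow (n : nat) (M : {vspace A}) :
    ({:A} * M <= M)%VS -> u \in M -> 1 \notin M ->
    (\dim {:A} - \dim M <= n)%N -> False.
  exfalso; apply: (grow _ ({:A} * <[u]>)%VS _ _ _ (leqnn _)).
  - by rewrite prodvA prodvSl ?subvf.
  - by rewrite -{1}[u]mul1r memv_mul ?memvf ?memv_line.
  apply: contra nUu => /memv_cosetP[v _ v1].
  by apply: (@unitr_left_inverse _ v).
elim: n M => [|n IHn] M MA Mu M1 leMn.
  case/negP: M1; suff -> : M = fullv by rewrite memvf.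
  by apply/eqP; rewrite eqEdim subvf -subn_eq0 -leqn0.
apply: (avoid (fun x => x \in M)) (Mu); split.
- split=> [|x y|a x Mx]; [exact: mem0v | exact: memvD |].
  by apply: subvP MA _ _; rewrite memv_mul ?memvf.
- exact/negP.
move=> I [I0 ID IM] MI I1 x Ix; apply: contraT => Mx; exfalso.
have IN y : y \in (M + {:A} * <[x]>)%VS -> I y.
  case/memv_addP=> m Mm [_ /memv_cosetP[a _ ->] ->].
  by apply: ID; [apply: MI | apply: IM].
have ltM : (\dim M < \dim (M + {:A} * <[x]>))%N.
  rewrite ltnNge; apply: contra Mx => le_dim.
  have /eqP-> : M == (M + {:A} * <[x]>)%VS by rewrite eqEdim addvSl.
  apply: subvP (addvSr _ _) _ _.
  by rewrite -{1}[x]mul1r memv_mul ?memvf ?memv_line.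
apply: (IHn (M + {:A} * <[x]>)%VS).
- by rewrite prodvDr addvS // prodvA prodvSl ?subvf.
- exact: subvP (addvSl _ _) _ Mu.
- by apply/negP=> /IN.
by lia.
Qed.

Lemma jacobson_unitrB (j : A) : jacobson j -> 1 - j \is a GRing.unit.
Proof.
move=> Jj; apply: unitr_avoid_maximal => M Mmax M1j.
have [[_ MD _] M1 _] := Mmax; apply: M1.
by rewrite -(subrK j 1); apply: MD; last exact: Jj.
Qed.

(* Nakayama's lemma; an element j * u + w of J<u> + JU that equals u lets
   1 - j be inverted, so u is redundant among the generators of <u> + U. *)
Lemma prodv_nakayama (J U : {vspace A}) :
    (forall j, j \in J -> 1 - j \is a GRing.unit) ->
  ({:A} * J <= J)%VS -> (U <= J * U)%VS -> U = 0%VS.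
Proof.
move=> J1 AJ; rewrite -(span_basis (vbasisP U)).
elim: (tval (vbasis U)) => [|u s IHs]; first by rewrite span_nil.
rewrite span_cons prodvDr subv_add => /andP[Hu Hs].
have uJs : u \in (J * <<s>>)%VS.
  have /memv_addP[_ /memv_cosetP[j Jj ->] [w Jw def_u]] := Hu.
  have def_w : (1 - j) * u = w.
    by rewrite mulrBl mul1r; apply/eqP; rewrite subr_eq addrC; apply/eqP.
  rewrite -[u](mulKr (J1 j Jj)) def_w.
  by apply: subvP (prodvSl _ AJ) _ _; rewrite -prodvA memv_mul ?memvf.
have AJs : (J * (J * <<s>>) <= J * <<s>>)%VS.
  by rewrite prodvA prodvSl // (subv_trans _ AJ) // prodvSl ?subvf.
have s0 : <<s>>%VS = 0%VS.
  apply: IHs; apply: subv_trans Hs _; rewrite subv_add subvv andbT.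
  by apply: subv_trans AJs; apply: prodvSr.
move: uJs; rewrite s0 prodv0 memv0 => /eqP->; rewrite addv0.
by apply/eqP; rewrite -dimv_eq0 dim_vline eqxx.
Qed.

(** By Nakayama's lemma the powers of [J] drop strictly in dimension until they vanish. *)
Lemma expv_nilpotent (J : {vspace A}) :
    (forall j, j \in J -> 1 - j \is a GRing.unit) ->
  ({:A} * J <= J)%VS -> (J ^+ (\dim {:A}).+1 = 0)%VS.
Proof.
move=> J1 AJ; suff dimJ n : (\dim (J ^+ n.+1) <= \dim {:A} - n)%N.
  by apply/eqP; rewrite -dimv_eq0 -leqn0 (leq_trans (dimJ _)) ?subnn.
elim: n => [|n IHn]; first by rewrite subn0 dimvS ?subvf.
have JS : (J ^+ n.+2 <= J ^+ n.+1)%VS.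
  rewrite !expvSl prodvA prodvSl // (subv_trans _ AJ) // prodvSl ?subvf //.
have [-> | Jn0] := eqVneq (J ^+ n.+2)%VS 0%VS; first by rewrite dimv0.
rewrite subnS -ltnS prednK.
  apply: leq_trans IHn; rewrite ltn_neqAle dimvS // andbT.
  apply: contra Jn0 => /eqP eq_dim.
  have /eqP eqJ : (J ^+ n.+2 == J ^+ n.+1)%VS by rewrite eqEdim JS eq_dim leqnn.
  by apply/eqP/(prodv_nakayama J1 AJ); rewrite eqJ -expvSl eqJ.
apply: leq_trans IHn; rewrite lt0n dimv_eq0; apply: contra Jn0 => /eqP J0.
by rewrite -subv0 -J0.
Qed.

End JacobsonRadical.

(** Take an eigenvalue [a] of left multiplication by [x]: an eigenvector is killed by [x - a%:A]. *)
Lemma nonunit_shift (F : closedFieldType) (A : falgType F) (x : A) :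
  exists a : F, x - a%:A \isn't a GRing.unit.
Proof.
pose e := vbasis {:A}; pose M := passmx.mxof e e (amull x).
have /closed_rootP[a] : size (char_poly M) != 1%N.
  by rewrite size_char_poly eqSS -lt0n adim_gt0.
rewrite -eigenvalue_root_char => /eigenvalueP[r Mr r0].
exists a; apply/negP=> Uxa; move/eqP: r0; apply.
pose v := passmx.vecof e r.
have eb : basis_of {:A} e := vbasisP _.
have xv : x * v = a *: v.
  have := passmx.hom_vecof e eb (amull x) r.
  rewrite lfunE /= -/M Mr => ->; rewrite /v /passmx.vecof scaler_sumr.
  by apply: eq_bigr => i _; rewrite mxE scalerA.
have v0 : v = 0.
  by rewrite -[v](mulKr Uxa) mulrBl -scalerAl mul1r xv subrr mulr0.
by apply/eqP; rewrite -(passmx.vecof_eq0 eb) -/v v0.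
Qed.

(** * Commutators twisted by a central element *)

Section TwistedCommutator.
Variables (F : fieldType) (A : falgType F).
Implicit Types (a b u v x y : A) (V W : {vspace A}).

Definition comm_twist u a b := (a * b - b * a) * u.

Lemma comm_twistC u a b : comm_twist u b a = - comm_twist u a b.
Proof. by rewrite /comm_twist -[RHS]mulNr opprB. Qed.

Lemma comm_twistDl u a a' b :
  comm_twist u (a + a') b = comm_twist u a b + comm_twist u a' b.
Proof.
by rewrite /comm_twist -[RHS]mulrDl (mulrDl a) (mulrDr b) opprD addrACA.
Qed.

Lemma comm_twistZl u k a b : comm_twist u (k *: a) b = k *: comm_twist u a b.
Proof. by rewrite /comm_twist -scalerAl -scalerAr -scalerBr -scalerAl. Qed.

Lemma comm_twist_scalar u k b : comm_twist u k%:A b = 0.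
Proof. by rewrite comm_twistZl /comm_twist mul1r mulr1 subrr mul0r scaler0. Qed.

Lemma comm_twistxx u a : comm_twist u a a = 0.
Proof. by rewrite /comm_twist subrr mul0r. Qed.

(** By bilinearity and antisymmetry, only the pair [x], [y] contributes modulo [W]. *)
Lemma comm_twist_sub u x y W :
    comm_twist u x y \in W ->
    (forall a, exists k l,
       forall b, comm_twist u (a - k *: x - l *: y) b \in W) ->
  forall a b, comm_twist u a b \in W.
Proof.
move=> Wxy Wgen.
have split a k l b : comm_twist u a b = comm_twist u (a - k *: x - l *: y) b
                     + k *: comm_twist u x b + l *: comm_twist u y b.
  by rewrite -!comm_twistZl -!comm_twistDl addrAC !subrK.
have Wx b : comm_twist u x b \in W.
  rewrite comm_twistC memvN; have [k [l Wb]] := Wgen b.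
  rewrite (split b k l) !memvD ?memvZ ?comm_twistxx ?mem0v //.
  by rewrite comm_twistC memvN.
have Wy b : comm_twist u y b \in W.
  rewrite comm_twistC memvN; have [k [l Wb]] := Wgen b.
  by rewrite (split b k l) !memvD ?memvZ ?comm_twistxx ?mem0v.
by move=> a b; have [k [l Wa]] := Wgen a; rewrite (split a k l) !memvD ?memvZ.
Qed.

Definition twist_center u := (amulr u @^-1: 'Z({:A}))%VS.

Lemma twist_centerP u a : (forall b, u * b = b * u) ->
  reflect (forall b, comm_twist u a b = 0) (a \in twist_center u).
Proof.
move=> cu; rewrite -memv_preim lfunE /= memv_cap memvf /=.
have E b : comm_twist u a b = a * u * b - b * (a * u).
  by rewrite /comm_twist mulrBl -!mulrA cu.
apply: (iffP centvP) => [cau b | au0 b _].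
  by rewrite E cau ?memvf // subrr.
by apply/eqP; rewrite -subr_eq0 -E au0.
Qed.

End TwistedCommutator.

(** * Codimension of the twisted center under a symmetrizing form *)

Section SymmetricLocal.
Variables (F : fieldType) (A : falgType F).
Variables (J : {vspace A}) (lam : 'Hom(A, F^o)).
Hypothesis J1 : forall j, j \in J -> 1 - j \is a GRing.unit.
Hypothesis AJ : ({:A} * J <= J)%VS.
Hypothesis JA : (J * {:A} <= J)%VS.
Hypothesis AFJ : forall a, exists k : F, a - k%:A \in J.
Hypothesis lamC : forall a b, lam (a * b) = lam (b * a).
Hypothesis lam_inj : forall x, (forall b, lam (x * b) = 0) -> x = 0.
Implicit Types (a b u v x y z : A) (V W : {vspace A}).

Local Notation br := comm_twist.
Local Notation central u := (forall b, u * b = b * u).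

Lemma lam_comm_twist u a b : central u -> lam (br u a b) = 0.
Proof.
by move=> cu; rewrite /br mulrBl linearB /= -!mulrA lamC -mulrA cu subrr.
Qed.

(** The orthogonal of [W] under lam (a b) has codimension at most dim W. It lies in the twisted
    center by the cyclic identity lam ([a, b] u d) = lam ([b, d] u a). *)
Lemma dim_twist_center u W : central u -> (forall a b, br u a b \in W) ->
  (\dim {:A} <= \dim (twist_center u) + \dim W)%N.
Proof.
move=> cu KW.
have perp (s : seq A) : exists2 U : {vspace A},
    (\dim {:A} <= \dim U + size s)%N &
    {in U & s, forall a w, lam (w * a) = 0}.
  elim: s => [|w s [U dimU Us]]; first by exists fullv => //; rewrite addn0.
  pose f := (lam \o amull w)%VF; exists (U :&: lker f)%VS.
    have := limg_ker_dim f U.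
    have : (\dim (f @: U) <= 1)%N.
      by rewrite (leq_trans (dimvS (subvf _))) ?dimvf.
    rewrite /=; lia.
  move=> a v; rewrite memv_cap memv_ker comp_lfunE lfunE /= inE.
  by case/andP=> Ua /eqP fa0 /predU1P[->|] //; apply: Us.
have [U dimU UW] := perp (vbasis W).
move: dimU; rewrite size_tuple => dimU; apply: leq_trans dimU _.
rewrite leq_add2r dimvS //; apply/subvP=> a Ua; apply/twist_centerP=> // b.
have perpW w : w \in W -> lam (w * a) = 0.
  move/coord_vbasis->; rewrite mulr_suml linear_sum big1 // => i _.
  by rewrite -scalerAl linearZ /= UW ?scaler0 ?mem_nth ?size_tuple.
apply: lam_inj => d; rewrite -(perpW _ (KW b d)) /br.
have cuA v w : u * (v * w) = v * (u * w) by rewrite mulrA cu -mulrA.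
rewrite !mulrBl !linearB /=; congr (_ - _).
  by rewrite -!mulrA lamC -!mulrA cuA.
by rewrite -!mulrA [RHS]lamC -!mulrA cuA.
Qed.

Lemma twist_center_codim2 u : central u ->
  (\dim {:A} <= \dim (twist_center u) + 2)%N -> forall a b, br u a b = 0.
Proof.
move=> cu dimC; set C := twist_center u in dimC *.
have [x [y defC']] : exists x y, (C^C = <[x]> + <[y]>)%VS.
  by apply: dimv_le2; rewrite dimv_compl leq_subLR.
have gen a : exists k l, a - k *: x - l *: y \in C.
  have : a \in (C + C^C)%VS by rewrite addv_complf memvf.
  rewrite defC' => /memv_addP[c Cc [_ /memv_addP[v xv [w yw ->]] ->]].
  have [[k ->] [l ->]] := (vlineP _ _ xv, vlineP _ _ yw).
  by exists k, l; rewrite -addrA -opprD addrK.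
have inW a b : br u a b \in <[br u x y]>%VS.
  apply: (comm_twist_sub (x := x) (y := y)); first exact: memv_line.
  move=> {}a; have [k [l /(twist_centerP _ cu) Ca]] := gen a.
  exists k, l => {}b.
  by rewrite Ca mem0v.
suff w0 : br u x y = 0.
  by move=> a b; move: (inW a b); rewrite w0 => /vlineP[k ->]; rewrite scaler0.
apply: lam_inj => a; suff /vlineP[k ->] : br u x y * a \in <[br u x y]>%VS.
  by rewrite linearZ /= lam_comm_twist // scaler0.
(* Split [a] into its parts along [C], [y] and [x]; the product of the commutator with each part is
   again a twisted commutator. *)
have [k [l Ca]] := gen a; rewrite -(subrK (k *: x) a) -(subrK (l *: y) (a - _)).
rewrite 2!mulrDr -!scalerAr 2?memvD ?memvZ //.
- move/(twist_centerP _ cu): Ca; move: (a - _ - _) => c Cc.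
  suff -> : br u x y * c = br u x (y * c) by [].
  have := Cc x; rewrite /br !mulrBl => /eqP; rewrite subr_eq0 => /eqP Ecx.
  by rewrite -!mulrA (cu c) [x * (c * u)]mulrA -Ecx !mulrA.
- by rewrite (_ : _ * y = br u (x * y) y) // /br !mulrBl -!mulrA cu.
by rewrite (_ : _ * x = br u x (y * x)) // /br !mulrBl -!mulrA cu.
Qed.

(** The twisted commutators already lie in [W :&: lker lam], so this space has dimension at least
    codim C >= 3; it is proper in [W] unless [lam] kills [W]. *)
Lemma comm_twist_dim3 u W : central u -> ~ (forall a b, br u a b = 0) ->
  (forall a b, br u a b \in W) ->
  (3 <= \dim W)%N /\ (~~ (W <= lker lam)%VS -> 4 <= \dim W)%N.
Proof.
move=> cu nc KW.
have dimC : (\dim (twist_center u) + 3 <= \dim {:A})%N.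
  by rewrite addnS ltnNge; apply/negP=> /(twist_center_codim2 cu).
have K0 : forall a b, br u a b \in (W :&: lker lam)%VS.
  by move=> a b; rewrite memv_cap KW memv_ker lam_comm_twist ?eqxx.
have dimW0 := dim_twist_center cu K0.
have sub0 := dimvS (capvSl W (lker lam)).
split=> [|nW0]; first by lia.
have : (\dim (W :&: lker lam) < \dim W)%N; last by lia.
rewrite ltn_neqAle sub0 andbT; apply: contra nW0 => /eqP eqd.
by apply/capv_idPl/eqP; rewrite eqEdim capvSl eqd leqnn.
Qed.

(** Substituting J <= D + J^2 into itself gives J <= D + J^n for every n >= 2, and [J] is
    nilpotent. *)
Lemma local_generation D : (D <= J)%VS -> (D * D <= D)%VS ->
  (J <= D + J ^+ 2)%VS -> (J <= D)%VS.
Proof.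
move=> DJ DD JD2.
have JD n : (J <= D + J ^+ n.+2)%VS.
  elim: n => [//|n IHn]; apply: subv_trans JD2 _; rewrite subv_add addvSl /=.
  rewrite expv2 (subv_trans (prodvSl J IHn)) // prodvDl -expvSr subv_add addvSr.
  rewrite (subv_trans (prodvSr D IHn)) // prodvDr subv_add.
  rewrite (subv_trans DD) ?addvSl //= expvSl (subv_trans _ (addvSr _ _)) //.
  by rewrite [X in (_ <= X)%VS]expvSl prodvSl.
have := JD (\dim {:A}); rewrite expvSl (expv_nilpotent J1 AJ) prodv0 addv0.
by [].
Qed.

(** * The layers J^n z for a central element z *)

Section CentralElement.
Variable z : A.
Hypothesis cz : central z.

(** As [J ^+ 0] is the line of scalars, [P 0] is only F z; the ideal A z is written [{:A} *
    <[z]>]. *)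
Local Notation P n := (J ^+ n * <[z]>)%VS.

Lemma mem_expv_line n a : a \in (J ^+ n)%VS -> a * z \in P n.
Proof. by move=> Ja; rewrite memv_mul ?memv_line. Qed.

Lemma mem_expv_line_mull n a w : a \in J -> w \in P n -> a * w \in P n.+1.
Proof.
move=> Ja /memv_cosetP[v Jv ->].
by rewrite mulrA mem_expv_line // expvSl memv_mul.
Qed.

Lemma mem_expv_line_mulr n a w : a \in J -> w \in P n -> w * a \in P n.+1.
Proof.
move=> Ja /memv_cosetP[v Jv ->].
by rewrite -mulrA cz mulrA mem_expv_line // expvSr memv_mul.
Qed.

Lemma expv_lineS n : (P n.+2 <= P n.+1)%VS.
Proof.
rewrite prodvSl // !expvSl prodvA prodvSl // (subv_trans _ AJ) //.
by rewrite prodvSl ?subvf.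
Qed.

Lemma expv_line_nakayama n : (P n <= P n.+1)%VS -> P n = 0%VS.
Proof. by rewrite expvSl -prodvA; apply: prodv_nakayama. Qed.

(** [P n.+1] is a right ideal, and [lker lam] contains no nonzero right ideal. *)
Lemma expv_line_lker n : (P n.+1 <= lker lam)%VS -> P n.+1 = 0%VS.
Proof.
move=> Plam; apply/eqP; rewrite -subv0; apply/subvP=> w Pw; rewrite memv0.
apply/eqP/lam_inj=> b; apply/eqP; rewrite -memv_ker; apply: subvP Plam _ _.
case/memv_cosetP: Pw => v Jv ->; rewrite -mulrA cz mulrA mem_expv_line //.
have JnA : (J ^+ n.+1 * {:A} <= J ^+ n.+1)%VS by rewrite expvSr -prodvA prodvSr.
by apply: subvP JnA _ _; rewrite memv_mul ?memvf.
Qed.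

Lemma comm_twist_square a b : br z a b \in P 2.
Proof.
have [[k Ja] [l Jb]] := (AFJ a, AFJ b).
rewrite -(subrK k%:A a) comm_twistDl comm_twist_scalar addr0.
rewrite -(subrK l%:A b) comm_twistC comm_twistDl comm_twist_scalar addr0.
by rewrite memvN mem_expv_line // memvB // expv2 memv_mul.
Qed.

Lemma annihilator_comm_twist a b : a * z = 0 -> br z a b = 0.
Proof.
by move=> az; rewrite /br mulrBl -!mulrA az -(cz b) mulrA az mulr0 mul0r subrr.
Qed.

Lemma comm_twistM_eq0 a b c :
  br z a c = 0 -> br z b c = 0 -> br z (a * b) c = 0.
Proof.
rewrite /br !mulrBl => /eqP; rewrite subr_eq0 => /eqP ac /eqP.
rewrite subr_eq0 => /eqP bc; apply/eqP; rewrite subr_eq0; apply/eqP.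
rewrite -(mulrA a b) -(mulrA a) bc -(mulrA c b) -(cz b) !mulrA ac.
by rewrite -!mulrA cz.
Qed.

Hypothesis nonabelian : ~ (forall a b, br z a b = 0).

(** Modulo J^2 and the annihilator of [z], every element of [J] is a multiple of [x], so [J :&: V]
    generates [J]. *)
Lemma radical_generated V x : x \in J -> (V * V <= V)%VS ->
  (forall a, a * z = 0 -> a \in V) -> x \in V ->
  (P 1 <= P 2 + <[x * z]>)%VS -> (J <= V)%VS.
Proof.
move=> Jx VV Vann Vx P1P2.
suff JVJ : (J <= J :&: V)%VS by rewrite (subv_trans JVJ) ?capvSr.
apply: local_generation; first exact: capvSl.
  rewrite subv_cap (subv_trans _ AJ) ?(subv_trans _ VV) //.
    by rewrite prodvS ?capvSr.
  by rewrite prodvS ?subvf ?capvSl.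
apply/subvP=> j Jj.
have /memv_addP[_ /memv_cosetP[q Jq ->] [_ /vlineP[k ->] jE]] :
    j * z \in (P 2 + <[x * z]>)%VS.
  by apply: subvP P1P2 _ _; apply: mem_expv_line.
have Jq' : q \in J.
  have JJ : (J ^+ 2 <= J)%VS.
    by rewrite expv2 (subv_trans _ AJ) // prodvSl ?subvf.
  exact: subvP JJ _ Jq.
rewrite -(subrK q j) memv_add // memv_cap memvB //=.
rewrite -(subrK (k *: x) (j - q)) memvD ?memvZ //; apply: Vann.
by rewrite !mulrBl jE -scalerAl addrAC addrK subrr.
Qed.

(** Otherwise A / ann(z) would be generated by one element, hence commutative. *)
Lemma dim_generators : (\dim (P 2) + 2 <= \dim (P 1))%N.
Proof.
rewrite addnS addn1 ltnNge; apply/negP=> dimP1; apply: nonabelian => a b.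
have [|v defv] := @dimv_le1 _ _ (P 1 :\: P 2)%VS.
  have := dimv_cap_compl (P 1) (P 2); rewrite (capv_idPr (expv_lineS 0)).
  by rewrite -(leq_add2l (\dim (P 2))) addn1 => ->.
have : v \in P 1.
  by apply: subvP (diffvSl (P 1) (P 2)) _ _; rewrite defv memv_line.
case/memv_cosetP=> x Jx defvx; subst v.
have P1gen : (P 1 <= P 2 + <[x * z]>)%VS.
  by rewrite -defv addvC addv_diff addvSl.
have memCx c :
    (c \in lker (amulr z \o (amulr x - amull x))%VF) = (br z c x == 0).
  by rewrite memv_ker comp_lfunE [amulr z _]lfunE /= add_lfunE opp_lfunE !lfunE.
(* First [V] is the preimage of the centralizer of [x] in A / ann(z). This puts [x] in the twisted
   center, which then serves as [V] in [JC]. *)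
have JCx : (J <= lker (amulr z \o (amulr x - amull x)))%VS.
  apply: radical_generated P1gen; rewrite ?memCx ?comm_twistxx //.
    apply/prodvP=> c d; rewrite !memCx => /eqP cx /eqP dx.
    by rewrite comm_twistM_eq0.
  by move=> c cz0; rewrite memCx annihilator_comm_twist.
have JC : (J <= twist_center z)%VS.
  apply: radical_generated P1gen => //.
  - apply/prodvP=> c d /(twist_centerP _ cz) Cc /(twist_centerP _ cz) Cd.
    by apply/twist_centerP=> // e; apply: comm_twistM_eq0.
  - by move=> c cz0; apply/twist_centerP=> // d; apply: annihilator_comm_twist.
  apply/twist_centerP=> // c; have [k Jc] := AFJ c; apply/eqP.
  rewrite comm_twistC -(subrK k%:A c) comm_twistDl comm_twist_scalar addr0.
  by rewrite oppr_eq0 -memCx; apply: subvP JCx _ Jc.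
have [k Ja] := AFJ a.
rewrite -(subrK k%:A a) comm_twistDl comm_twist_scalar addr0.
exact: (twist_centerP _ cz (subvP JC _ Ja)).
Qed.

Lemma dim_radical_layers : [/\ 4 <= \dim (P 2), \dim (P 2) + 2 <= \dim (P 1)
  & \dim (P 1) < \dim ({:A} * <[z]>)]%N.
Proof.
split; last 1 first.
- have P1A : (P 1 <= {:A} * <[z]>)%VS by rewrite prodvSl ?subvf.
  (* Equality would give z = j z with j in [J], whereas 1 - j is invertible. *)
  rewrite ltn_neqAle dimvS // andbT; apply/eqP=> eqd; apply: nonabelian => a b.
  have : z \in P 1.
    have /eqP-> : P 1 == ({:A} * <[z]>)%VS by rewrite eqEdim P1A eqd leqnn.
    by rewrite -{1}[z]mul1r memv_mul ?memvf ?memv_line.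
  case/memv_cosetP=> j Jj zE; rewrite /br.
  suff -> : z = 0 by rewrite mulr0.
  by rewrite -[z](mulKr (J1 Jj)) mulrBl mul1r -zE subrr mulr0.
- have [d3 d4] := comm_twist_dim3 cz nonabelian comm_twist_square.
  apply: d4; apply/negP=> /expv_line_lker P20.
  by move: d3; rewrite P20 dimv0.
exact: dim_generators.
Qed.

(* If a * b * z = m a b *: c modulo P 3 for a, b in J, expanding a * b * d * z
   in two ways gives m a b *: (c * d) = m b d *: (a * c) modulo P 4; were c * d
   nonzero there, m a b would be proportional to m a d * m b d, hence symmetric,
   whereas m x y - m y x = 1. *)
Lemma cube_vanish x y (c := br z x y) : x \in J -> y \in J -> c \notin P 3 ->
  (P 2 <= <[c]> + P 3)%VS -> P 3 = 0%VS.
Proof.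
move=> Jx Jy cP3 P2W; apply: expv_line_nakayama.
have cP2 : c \in P 2 := comm_twist_square x y.
have [m mE] : exists m : A -> A -> F, forall a b, a \in J -> b \in J ->
    a * b * z - m a b *: c \in P 3.
  (* The implication is vacuous outside [J], which makes [m] a total function. *)
  have ex a b : exists k : F,
      [&& a \in J & b \in J] ==> (a * b * z - k *: c \in P 3).
    have [/andP[Ja Jb]|] := boolP [&& a \in J & b \in J]; last by exists 0.
    have : a * b * z \in (<[c]> + P 3)%VS.
      by apply: subvP P2W _ _; rewrite mem_expv_line // expv2 memv_mul.
    case/memv_addP=> _ /vlineP[k ->] [w Pw ->]; exists k.
    by rewrite addrC addKr.
  exists (fun a b => xchoose (ex a b)) => a b Ja Jb.
  by move: (xchooseP (ex a b)) => /implyP; apply; rewrite Ja Jb.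
have m1 : m x y - m y x = 1.
  apply/eqP; apply: contraNT cP3; rewrite -subr_eq0 => m1.
  rewrite -[c](scalerK m1) memvZ // 2!scalerBl scale1r.
  have -> : m x y *: c - m y x *: c - c =
     (y * x * z - m y x *: c) - (x * y * z - m x y *: c) .
    have cE : c = x * y * z - y * x * z by rewrite /c /br mulrBl.
    move: (m x y *: c) (m y x *: c) => p q; rewrite cE !opprB.
    by rewrite addrACA [RHS]addrACA (addrC p).
  by rewrite memvB ?mE.
have mC a b d : a \in J -> b \in J -> d \in J ->
    m a b *: (c * d) - m b d *: (a * c) \in P 4.
  move=> Ja Jb Jd.
  have -> : m a b *: (c * d) - m b d *: (a * c) =
    a * (b * d * z - m b d *: c) - (a * b * z - m a b *: c) * d.
    rewrite mulrBr mulrBl -scalerAr -scalerAl -!mulrA (cz d).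
    by rewrite opprB [RHS]addrC addrA subrK.
  by rewrite memvB ?(mem_expv_line_mull Ja) ?(mem_expv_line_mulr Jd) ?mE.
have cJ d : d \in J -> c * d \in P 4.
  move=> Jd; apply: contraT => cd4; exfalso.
  have coef0 k : k *: (c * d) \in P 4 -> k = 0.
    move=> kP; apply/eqP; apply: contraNT cd4 => k0.
    by rewrite -[c * d](scalerK k0) memvZ.
  have mfree a b b0 : a \in J -> b \in J -> b0 \in J ->
      m b0 d * m a b = m b d * m a b0.
    move=> Ja Jb Jb0; apply/eqP; rewrite -subr_eq0; apply/eqP/coef0.
    rewrite (_ : _ *: _ = m b0 d *: (m a b *: (c * d) - m b d *: (a * c)) -
       m b d *: (m a b0 *: (c * d) - m b0 d *: (a * c))).
      by rewrite memvB ?memvZ ?mC.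
    rewrite !scalerBr !scalerA scalerBl [m b d * m b0 d]mulrC.
    by rewrite opprB addrA subrK.
  (* One of [x], [y] works: were both coefficients zero, [mC] would force m x y = m y x = 0, against
     [m1]. *)
  have [b0 Jb0 fb0] : exists2 b0, b0 \in J & m b0 d != 0.
    have [fx|] := eqVneq (m x d) 0; last by exists x.
    have [fy|] := eqVneq (m y d) 0; last by exists y.
    have mxy : m x y = 0.
      by apply: coef0; have := mC x y d Jx Jy Jd; rewrite fy scale0r subr0.
    have myx : m y x = 0.
      by apply: coef0; have := mC y x d Jy Jx Jd; rewrite fx scale0r subr0.
    by move/eqP: m1; rewrite mxy myx subrr eq_sym oner_eq0.
  have fd a : a \in J -> m b0 d * m a d = m d d * m a b0.
    by move=> Ja; apply: mfree.
  have fd0 : m d d != 0.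
    apply: contra fb0 => /eqP fd0; have /eqP := fd _ Jb0.
    by rewrite fd0 mul0r mulf_eq0 orbb.
  have msym a b : a \in J -> b \in J -> m d d * m a b = m a d * m b d.
    move=> Ja Jb; apply: (mulfI fb0).
    by rewrite mulrCA (mfree a b b0) // [LHS]mulrCA -(fd a) // [LHS]mulrC mulrA.
  have : m x y = m y x by apply: (mulfI fd0); rewrite !msym // mulrC.
  by move/eqP; rewrite -subr_eq0 m1 oner_eq0.
have JzC : (J * <[z]> <= <[z]> * J)%VS.
  apply/prodvP=> a _ Ja /vlineP[k ->].
  by rewrite -scalerAr -cz scalerAl memv_mul ?memvZ ?memv_line.
have P3E : (P 3 <= P 2 * J)%VS by rewrite expvSr -!prodvA !prodvSr.
(* P 3 <= P 2 J <= (F c + P 3) J <= P 4, using [cJ]. *)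
apply: subv_trans P3E _; apply/prodvP=> u d /(subvP P2W).
case/memv_addP=> _ /vlineP[k ->] [w Pw ->] Jd.
by rewrite mulrDl memvD -?scalerAl ?memvZ ?cJ ?(mem_expv_line_mulr Jd).
Qed.

Lemma dim_noncommutative : (8 <= \dim ({:A} * <[z]>))%N.
Proof.
have [d2 d1 d0] := dim_radical_layers; rewrite leqNgt; apply/negP=> d8.
have [e2 e1] : \dim (P 2) = 4 /\ \dim (P 1) = 6 by lia.
have [|v [w defvw]] := @dimv_le2 _ _ (P 1 :\: P 2)%VS.
  have := dimv_cap_compl (P 1) (P 2); rewrite (capv_idPr (expv_lineS 0)) e1 e2.
  by rewrite -(leq_add2l 4) => ->.
have Pv u : u \in (<[v]> + <[w]>)%VS -> u \in P 1.
  by rewrite -defvw; apply: subvP (diffvSl (P 1) (P 2)) u.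
have [x Jx defv] : exists2 x, x \in J & v = x * z.
  by apply/memv_cosetP/Pv; apply: subvP (addvSl _ _) _ (memv_line v).
have [y Jy defw] : exists2 y, y \in J & w = y * z.
  by apply/memv_cosetP/Pv; apply: subvP (addvSr _ _) _ (memv_line w).
pose c := br z x y; pose W := (<[c]> + P 3)%VS.
(* Modulo J^2 and the annihilator of [z], [J] is spanned by [x] and [y]; commutators of J^2 with
   [J], times [z], fall into [P 3]. *)
have KW a b : br z a b \in W.
  apply: (comm_twist_sub (x := x) (y := y)).
    by apply: subvP (addvSl _ _) _ (memv_line c).
  move=> {b}a; have [k Jak] := AFJ a.
  have [j [Jj ->]] : exists j, j \in J /\ a = j + k%:A.
    by exists (a - k%:A); rewrite subrK.
  have : j * z \in (P 1 :\: P 2 + P 2)%VS.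
    by rewrite addv_diff; apply: subvP (addvSl _ _) _ _; apply: mem_expv_line.
  rewrite defvw => /memv_addP[_ /memv_addP[v' vv' [w' ww' ->]]].
  case=> _ /memv_cosetP[q Jq ->] jE.
  have [[r rE] [s sE]] := (vlineP _ _ vv', vlineP _ _ ww').
  rewrite {}rE {}sE {vv' ww'} in jE; exists r, s => b.
  have -> : j + k%:A - r *: x - s *: y = k%:A + (q + (j - r *: x - s *: y - q)).
    by rewrite [q + _]addrC subrK !addrA [k%:A + _]addrC.
  rewrite comm_twistDl comm_twist_scalar add0r comm_twistDl addrC.
  rewrite annihilator_comm_twist ?add0r; last first.
    rewrite !mulrBl jE defv defw -!scalerAl.
    move: (r *: (x * z)) (s *: (y * z)) (q * z) => X Y Z.
    by rewrite -(addrA _ (- X)) -opprD addrAC addrK subrr.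
  apply: subvP (addvSr _ _) _ _; have [l Jb] := AFJ b.
  rewrite -(subrK l%:A b) comm_twistC comm_twistDl comm_twist_scalar addr0.
  rewrite memvN mem_expv_line // memvB //; first by rewrite expvSl memv_mul.
  by rewrite expvSr memv_mul.
have [d3 d4] := comm_twist_dim3 cz nonabelian KW.
have P30 : P 3 != 0%VS.
  apply/eqP=> P30; move: d3; rewrite /W P30 addv0 dim_vline; lia.
(* [W] contains the nonzero ideal [P 3], which [lam] does not kill, so dim W >= 4 = dim (P 2). *)
have P2W : (P 2 <= W)%VS.
  have WP2 : (W <= P 2)%VS.
    by rewrite subv_add expv_lineS andbT; apply: comm_twist_square.
  rewrite -(geq_leqif (dimv_leqif_sup WP2)) e2; apply: d4.
  by apply: contra P30 => /(subv_trans (addvSr _ _))/expv_line_lker->.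
case/eqP: P30; apply: (cube_vanish Jx Jy _ P2W).
apply/negP=> cP3; have : P 2 = 0%VS.
  apply: expv_line_nakayama; apply: subv_trans P2W _.
  by rewrite subv_add -memvE cP3 subvv.
by move=> P20; move: e2; rewrite P20 dimv0.
Qed.

End CentralElement.

(** * Central elements of the radical annihilate commutators *)

Lemma radical_center_comm z a b : (\dim {:A} <= 11)%N -> z \in J -> central z ->
  br z a b = 0.
Proof.
move=> dimA Jz cz; have [le7 | ge8] := leqP (\dim ({:A} * <[z]>)) 7.
  apply/eqP; apply: contraT => nab.
  have := dim_noncommutative cz (fun K0 => elimN eqP nab (K0 a b)).
  by rewrite leqNgt ltnS le7.
have czX m : central (z ^+ m) by move=> c; apply/esym/commrX.
have step m : (forall c d, br (z ^+ m.+1) c d = 0) ->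
    forall c d, br (z ^+ m) c d = 0.
  move=> brS; apply: twist_center_codim2 => //.
  have C1 : 1 \in twist_center (z ^+ m).
    by apply/twist_centerP=> // c; rewrite -[1]scale1r comm_twist_scalar.
  have zAC : ({:A} * <[z]> <= twist_center (z ^+ m)%R)%VS.
    apply/subvP=> _ /memv_cosetP[c _ ->]; apply/twist_centerP=> // d.
    by rewrite -(brS c d) /br exprS mulrA -(mulrA c) cz !mulrA -mulrBl.
  (* A z together with 1 gives the twisted center dimension at least 9, hence codimension at most
     2. *)
  suff : (\dim ({:A} * <[z]>) < \dim (twist_center (z ^+ m)))%N by lia.
  rewrite ltn_neqAle dimvS // andbT; apply/eqP=> eqd.
  have : 1 \in ({:A} * <[z]>)%VS.
    have /eqP-> : ({:A} * <[z]> == twist_center (z ^+ m)%R)%VS.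
      by rewrite eqEdim zAC eqd leqnn.
    exact: C1.
  case/memv_cosetP=> c _ cz1; have := J1 (subvP AJ _ (memv_mul (memvf c) Jz)).
  by rewrite -cz1 subrr unitr0.
have zN : z ^+ (\dim {:A}).+1 = 0.
  apply/eqP; rewrite -memv0 -(expv_nilpotent J1 AJ) memvE -expv_line.
  by apply: expvS; rewrite -memvE.
(* The exponent descends from dim A + 1, where the power vanishes, to 0, where the commutators are
   untwisted. *)
have down k : forall c d, br (z ^+ ((\dim {:A}).+1 - k)) c d = 0.
  elim: k => [|k IHk]; first by move=> c d; rewrite subn0 zN /br mulr0.
  by rewrite subnS; case: (_ - k)%N IHk => // m; apply: step.
have := down (\dim {:A}).+1 a b; rewrite subnn expr0 /br mulr1 => ->.
by rewrite mul0r.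
Qed.

End SymmetricLocal.

(** * The radical of a local algebra and of its center *)

Section LocalAlgebra.
Variables (F : closedFieldType) (A : falgType F).
Hypothesis Aloc : is_local A.
Implicit Types (x : A).

Lemma jacobson_nonunit x : jacobson x -> x \isn't a GRing.unit.
Proof.
move=> Jx; apply/negP=> Ux; case: Aloc => nJ1 _; apply: nJ1.
by rewrite -(mulVr Ux); have [_ _] := jacobson_left_ideal A; apply.
Qed.

(* Maximality of M turns the double negation of [jacobson x] into M x, so
   that the Prop-valued ideals need no excluded middle. *)
Lemma nonunit_jacobson x : x \isn't a GRing.unit -> jacobson x.
Proof.
move=> nUx M Mmax; have [[M0 MD MM] M1 maxM] := Mmax.
have nnJ : ~ ~ jacobson x.
  case: Aloc => _ loc /loc[y [Jxy _]]; case/negP: nUx.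
  have [_ _ JM] := jacobson_left_ideal A.
  have := jacobson_unitrB (JM (-1) _ Jxy).
  by rewrite mulN1r opprK addrC subrK => /unitr_mull.
apply: (maxM (fun w => exists m a, M m /\ w = m + a * x)).
- split=> [|u v [m [a [Mm ->]]] [n [b [Mn ->]]]|c u [m [a [Mm ->]]]].
  + by exists 0, 0; rewrite mul0r addr0.
  + by exists (m + n), (a + b); rewrite mulrDl addrACA; split=> //; apply: MD.
  + by exists (c * m), (c * a); rewrite mulrDr mulrA; split=> //; apply: MM.
- by move=> m Mm; exists m, 0; rewrite mul0r addr0.
- case=> m [a [Mm m1]]; apply: nnJ => Jx; apply: M1; rewrite m1.
  by apply: MD => //; apply: MM; apply: Jx.
by exists 0, 1; rewrite mul1r add0r.
Qed.

(** A subspace realizing the Prop-valued radical allows dimension counts. It is spanned by the basis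
    vectors, each shifted by a scalar to a nonunit. *)
Lemma local_radical : exists2 J : {vspace A},
  forall x, (x \in J) = (x \isn't a GRing.unit) &
  forall x, x \in J -> 1 - x \is a GRing.unit.
Proof.
have [J0 JD JM] := jacobson_left_ideal A.
have JZ k x : jacobson x -> jacobson (k *: x).
  by move=> Jx; rewrite -[x]mul1r scalerAl; apply: JM.
pose sh x := x - (xchoose (nonunit_shift x))%:A.
have Jsh x : jacobson (sh x).
  exact: (nonunit_jacobson (xchooseP (nonunit_shift x))).
pose J := <<[seq sh e | e <- vbasis {:A}]>>%VS.
have JJ x : x \in J -> jacobson x.
  rewrite /J span_def big_map; elim: (tval (vbasis _)) x => [|e s IHs] x.
    by rewrite big_nil memv0 => /eqP->.
  rewrite big_cons => /memv_addP[_ /vlineP[k ->] [v sv ->]].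
  exact: JD (JZ _ _ (Jsh _)) (IHs _ sv).
exists J => [x|x /JJ /jacobson_unitrB //].
apply/idP/idP=> [/JJ /jacobson_nonunit // | /nonunit_jacobson Jx].
have [k Jk] : exists k, x - k%:A \in J.
  rewrite (coord_vbasis (memvf x)).
  exists (\sum_i coord (vbasis {:A}) i x
                   * xchoose (nonunit_shift (vbasis {:A})`_i)).
  rewrite scaler_suml -sumrB; apply: memv_suml => i _.
  rewrite -scalerA -scalerBr; apply/memvZ/memv_span/(map_f sh).
  by rewrite mem_nth ?size_tuple.
(* Both [x] and [x - k%:A] lie in the radical, hence so does [k%:A]; but 1 does not. *)
suff k0 : k = 0 by move: Jk; rewrite k0 scale0r subr0.
apply/eqP; apply: contraT => nk0; case: Aloc => nJ1 _; case: nJ1.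
rewrite -(scalerK nk0 1) -(subKr x k%:A) -scaleN1r.
exact: (JZ _ _ (JD _ _ Jx (JZ (-1) _ (JJ _ Jk)))).
Qed.

(** For a maximal ideal [M] of the center Z, M + Z x is proper: 1 = m + a x would make m = 1 - a x
    invertible in [A], hence in Z, since a x is a nonunit. So [M] contains [x]. *)
Lemma jacobson_centerP x :
  jacobson_center A x <-> (forall a, x * a = a * x) /\ x \isn't a GRing.unit.
Proof.
split=> [[z Jz <-] | [cx nUx]].
  split.
    have := subvsP z; rewrite memv_cap memvf => /centvP cz a.
    by rewrite cz ?memvf.
  apply/negP=> /vsval_unitr Uz.
  have [_ _ JM] := jacobson_left_ideal (subvs_of 'Z({:A})%AS).
  have := jacobson_unitrB (JM z^-1 z Jz).
  by rewrite mulVr // subrr unitr0.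
have Zx : x \in 'Z({:A})%VS.
  by rewrite memv_cap memvf; apply/centvP=> a _; rewrite cx.
exists (Subvs Zx) => // M [[M0 MD MM] M1 maxM].
have vs1 : vsval (1 : subvs_of 'Z({:A})%AS) = 1.
  have: algid {:A} == 1 by rewrite algid_eq1 memvf.
  by rewrite -algid_center => /eqP.
apply: (maxM (fun w => exists m a, M m /\ w = m + a * Subvs Zx)).
- split=> [|u v [m [a [Mm ->]]] [n [b [Mn ->]]]|c u [m [a [Mm ->]]]].
  + by exists 0, 0; rewrite mul0r addr0.
  + by exists (m + n), (a + b); rewrite mulrDl addrACA; split=> //; apply: MD.
  + by exists (c * m), (c * a); rewrite mulrDr mulrA; split=> //; apply: MM.
- by move=> m Mm; exists m, 0; rewrite mul0r addr0.
- case=> m [a [Mm m1]]; apply: M1.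
  have mE : vsval m = 1 - vsval a * x.
    by rewrite -vs1 m1 /= addrK.
  have Um : m \is a GRing.unit.
    apply: vsval_unitr; rewrite mE; apply: jacobson_unitrB.
    apply: nonunit_jacobson; apply: contra nUx; apply: unitr_mulr.
  by rewrite -(mulVr Um); apply: MM.
by exists 0, 1; rewrite mul1r add0r.
Qed.

End LocalAlgebra.

(** * The ideal property of the radical of the center *)

Theorem theorem4p10 (F : closedFieldType) (A : falgType F)
    (Asym : symmetric_algebra A) (Aloc : is_local A)
    (dimA : (\dim {:A} <= 11)%N) :
  ideal (jacobson_center A).
Proof.
have [beta [beta_nd betaA]] := Asym.
have [J JE J1] := local_radical Aloc.
pose lam : 'Hom(A, F^o) := linfun (applyr beta 1 : A -> F^o).
have lamE a b : lam (a * b) = beta a b by rewrite lfunE /= betaA mulr1.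
have lamC a b : lam (a * b) = lam (b * a).
  by rewrite !lamE hermC /= expr0 mul1r.
have lam_inj x : (forall b, lam (x * b) = 0) -> x = 0.
  move=> x0; apply/eqP; rewrite -memv0 -(eqP beta_nd).
  by apply/mem_orthovP=> b _; rewrite -lamE.
have AJ : ({:A} * J <= J)%VS.
  by apply/prodvP=> a j _; rewrite !JE; apply: contra; apply: unitr_mulr.
have JA : (J * {:A} <= J)%VS.
  apply/prodvP=> j a; rewrite !JE => nUj _.
  by apply: contra nUj; apply: unitr_mull.
have AFJ a : exists k : F, a - k%:A \in J.
  by have [k nU] := nonunit_shift a; exists k; rewrite JE.
have comm0 z a b :
    z \in J -> (forall c, z * c = c * z) -> z * (a * b) = z * (b * a).
  move=> Jz cz.
  have := radical_center_comm J1 AJ JA AFJ lamC lam_inj a b dimA Jz cz.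
  by rewrite /comm_twist mulrBl -!cz => /eqP; rewrite subr_eq0 => /eqP.
(* [a * x] is central since [x] kills commutators: a x b = x a b = x b a = b a x. *)
have mulJZ a x : jacobson_center A x -> jacobson_center A (a * x).
  case/(jacobson_centerP Aloc)=> cx nUx; apply/(jacobson_centerP Aloc).
  split=> [b|]; last by apply: contra nUx; apply: unitr_mulr.
  by rewrite -(cx a) -mulrA comm0 ?JE // mulrA (cx b) mulrA.
split; first split=> //.
- apply/(jacobson_centerP Aloc); rewrite unitr0; split=> // a.
  by rewrite mulr0 mul0r.
- move=> x y /(jacobson_centerP Aloc)[cx nUx] /(jacobson_centerP Aloc)[cy nUy].
  apply/(jacobson_centerP Aloc); split=> [a|].
    by rewrite mulrDl mulrDr cx cy.
  by rewrite -JE memvD ?JE.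
move=> a x Jx; have /(jacobson_centerP Aloc)[cx _] := Jx.
by rewrite cx; apply: mulJZ.
Qed.
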